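(* For a symmetric indeterminate moment problem the properties (ac) and (aci) are equivalent.
   Context: Let $\mu$ be a probability measure on $\mathbb{R}$ with infinite support and moments $s_n=\int x^n\,d\mu(x)$ of every order $n\ge0$. The Hamburger moment problem is indeterminate if $\mu$ is not the only measure on $\mathbb{R}$ with these moments. Let $P_n(x)=\sum_{k=0}^n b_{k,n}x^k$ be the orthonormal polynomials of $\mu$ (positive leading coefficients). The moment problem is symmetric if the orthonormal polynomials satisfy a recurrence $xP_n(x)=b_nP_{n+1}(x)+b_{n-1}P_{n-1}(x)$, $n\ge0$ (with $P_{-1}=0$), for positive numbers $b_n$; equivalently all odd moments vanish. In the indeterminate case $K(z,w)=\sum_{n=0}^\infty P_n(z)P_n(w)$ is an entire function of two variables; write $K(z,w)=\sum_{j,k\ge0}a_{j,k}z^jw^k$; one has $a_{k,l}=\sum_{n\ge\max(k,l)}b_{k,n}b_{l,n}$ (absolutely convergent). Property (ac): for all $i,j\ge0$ the series $\sum_{k=0}^\infty a_{i,k}s_{k+j}$ is absolutely convergent. Property (aci): (ac) holds and $\sum_{k=0}^\infty a_{i,k}s_{k+j}=\delta_{i,j}$ for all $i,j\ge0$. *)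

(* Defs.v *)
From HB Require Import structures.
From mathcomp Require Import all_boot all_order all_algebra.
From mathcomp Require Import all_classical all_reals all_analysis.
From mathcomp Require Import complex.

Set Implicit Arguments.
Unset Strict Implicit.
Unset Printing Implicit Defensive.

Import Order.TTheory GRing.Theory Num.Theory numFieldNormedType.Exports.

Local Open Scope classical_set_scope.
Local Open Scope ring_scope.

Definition msupport (R : realType)
    (mu : {measure set (measurableTypeR R) -> \bar R}) : set R :=
  [set x | forall U : set R, open U -> U x -> (0 < mu U)%E].

Definition has_moments (R : realType)
    (mu : {measure set (measurableTypeR R) -> \bar R}) : Prop :=
  forall n : nat, mu.-integrable setT (fun x : R => (x ^+ n)%:E).

Definition moment (R : realType)
    (mu : {measure set (measurableTypeR R) -> \bar R}) (n : nat) : R :=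
  (\int[mu]_x ((x : R) ^+ n))%R.

(* The measures are compared as functions on Borel sets, not as bundled
   structures. *)
Definition indeterminate (R : realType)
    (mu : {measure set (measurableTypeR R) -> \bar R}) : Prop :=
  exists nu : {measure set (measurableTypeR R) -> \bar R},
    [/\ has_moments nu,
        forall n : nat, moment nu n = moment mu n &
        exists2 A : set (measurableTypeR R), measurable A & nu A <> mu A].

Definition orthonormal_polys (R : realType)
    (mu : {measure set (measurableTypeR R) -> \bar R})
    (P : nat -> {poly R}) : Prop :=
  [/\ forall n : nat, size (P n) = n.+1,
      forall n : nat, 0 < lead_coef (P n) &
      forall m n : nat,
        (\int[mu]_x ((P m).[x : R] * (P n).[x : R]))%R = (m == n)%:R].

(* The first equation is the case n = 0 of
   x P_n = b_n P_(n+1) + b_(n-1) P_(n-1), with P_(-1) = 0. *)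
Definition symmetric_recurrence (R : realType) (P : nat -> {poly R}) : Prop :=
  exists b : nat -> R,
    [/\ forall n : nat, 0 < b n,
        'X * P 0 = b 0 *: P 1 &
        forall n : nat, 'X * P n.+1 = b n.+1 *: P n.+2 + b n *: P n].

Definition ceval (R : realType) (p : {poly R}) (z : R[i]) : R[i] :=
  (map_poly (real_complex R) p).[z].

Definition moment_kernel (R : realType) (P : nat -> {poly R}) (z w : R[i])
    : R[i]^o :=
  limn (series (fun n : nat => ceval (P n) z * ceval (P n) w : R[i]^o)).

(* F(z, w) = \sum_(j, k) a_(j, k) z^j w^k on C^2, the double series being
   absolutely convergent; its sum may then be computed along squares. *)
Definition double_power_series (R : realType) (F : R[i] -> R[i] -> R[i]^o)
    (a : nat -> nat -> R) : Prop :=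
  forall z w : R[i],
    summable [set: nat * nat] (fun jk : nat * nat =>
      (`|a jk.1 jk.2| * ComplexField.Normc.normc z ^+ jk.1
                      * ComplexField.Normc.normc w ^+ jk.2)%:E) /\
    (fun N : nat => \sum_(j < N) \sum_(k < N)
       real_complex R (a j k) * z ^+ j * w ^+ k : R[i]^o) @ \oo --> F z w.

(* The array of power series coefficients of the kernel; the default value of
   xget is irrelevant, as such an array exists in the indeterminate case. *)
Definition kernel_coef (R : realType) (P : nat -> {poly R}) : nat -> nat -> R :=
  xget (fun _ _ => 0) [set a | double_power_series (moment_kernel P) a].

Definition prop_ac (R : realType)
    (mu : {measure set (measurableTypeR R) -> \bar R}) (P : nat -> {poly R})
    : Prop :=
  forall i j : nat,
    cvgn [normed series (fun k => kernel_coef P i k * moment mu (k + j))].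

Definition prop_aci (R : realType)
    (mu : {measure set (measurableTypeR R) -> \bar R}) (P : nat -> {poly R})
    : Prop :=
  prop_ac mu P /\
  forall i j : nat,
    series (fun k => kernel_coef P i k * moment mu (k + j)) @ \oo
      --> ((i == j)%:R : R).

(* Main.v *)
Require Import Defs.
From mathcomp Require Import all_boot all_order all_algebra.
From mathcomp Require Import all_classical all_reals all_analysis.
From mathcomp Require Import measurable_realfun complex.
From mathcomp Require Import zify ring lra.

(* Symmetry makes all terms b_(i,n) b_(k,n) of the series for a_(i,k) have the
   same sign, so that every truncation A^M_(i,k) = \sum_(n < M) b_(i,n) b_(k,n)
   satisfies |A^M_(i,k)| <= |a_(i,k)|.  For M > j, expanding x^j in the P_n
   gives \sum_k A^M_(i,k) s_(k+j) = delta_(i,j); under (ac) dominated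
   convergence lets M tend to infinity.

   The a_(i,k) exist because, in the indeterminate case, the series of
   |P_n(ir)|^2 = (\sum_k |b_(k,n)| r^k)^2 converges for every r > 0.  Indeed let
   mu and nu have the same moments, u(x) = 1 / (x^2 + r^2), and suppose that
   u^k q has the same integral for both measures, for every polynomial q.  The
   functional Lam q = \int u^(k+1) q d(mu - nu) then depends only on q modulo
   x^2 + r^2.  For p = \sum_(n < N, n even) P_n(ir) P_n this gives
   Lam (p q) = T Lam q with T = p(ir) = \int p^2 d mu = \int p^2 d nu, whereas
   Cauchy-Schwarz bounds |Lam (p q)| by a multiple of the square root of T; odd
   n are similar.  So if the series diverges, then Lam = 0, and by induction mu
   and nu agree on all u^k q.  Such functions approximate boundedly the
   indicators of half-lines, hence mu = nu. *)

Set Implicit Arguments.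
Unset Strict Implicit.
Unset Printing Implicit Defensive.

Import Order.TTheory GRing.Theory Num.Theory numFieldNormedType.Exports.

Local Open Scope classical_set_scope.
Local Open Scope ring_scope.

Local Notation normc := ComplexField.Normc.normc.

(** * Symmetric orthonormal polynomials *)

Section SymmetricPolynomials.
Variables (R : realType) (P : nat -> {poly R}) (b : nat -> R).
Hypothesis size_P : forall n, size (P n) = n.+1.
Hypothesis lead_P : forall n, 0 < lead_coef (P n).
Hypothesis b_gt0 : forall n, 0 < b n.
Hypothesis rec0 : 'X * P 0 = b 0 *: P 1.
Hypothesis recS : forall n, 'X * P n.+1 = b n.+1 *: P n.+2 + b n *: P n.

Lemma symmetric_coef0 k : (P 0)`_k = lead_coef (P 0) *+ (k == 0)%N.
Proof.
case: k => [|k]; first by rewrite lead_coefE size_P.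
by rewrite nth_default ?size_P.
Qed.

Lemma symmetric_coef1 k :
  (P 1)`_k = (b 0)^-1 * lead_coef (P 0) *+ (k == 1)%N.
Proof.
have /(congr1 (fun p : {poly R} => p`_k)) := rec0.
rewrite coefXM coefZ => e.
have -> : (P 1)`_k = (b 0)^-1 * (b 0 * (P 1)`_k).
  by rewrite mulKf // gt_eqF.
rewrite -e; case: k {e} => [|k] /=; first by rewrite mulr0 mulr0n.
by rewrite symmetric_coef0 eqSS mulrnAr.
Qed.

Lemma symmetric_coefSS n k :
  b n.+1 * (P n.+2)`_k =
  (if k is k'.+1 then (P n.+1)`_k' else 0) - b n * (P n)`_k.
Proof.
have /(congr1 (fun p : {poly R} => p`_k)) := recS n.
rewrite coefXM coefD !coefZ => e.
by apply/eqP; rewrite eq_sym subr_eq -e; case: k {e}.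
Qed.

Lemma symmetric_coef_odd n k : odd (n + k) -> (P n)`_k = 0.
Proof.
suff: (forall k, odd (n + k) -> (P n)`_k = 0) /\
      (forall k, odd (n.+1 + k) -> (P n.+1)`_k = 0) by case=> + _; apply.
elim: n {k} => [|n [IH0 IH1]].
  split=> k; first by rewrite symmetric_coef0; case: k.
  by rewrite symmetric_coef1; case: k => [|[|k]] //; rewrite mulr0n.
split=> // k ok; apply/eqP.
rewrite -[_ == _]orFb -(gt_eqF (b_gt0 n.+1)) -mulf_eq0 symmetric_coefSS.
rewrite IH0 1?mulr0 ?subr0; last by move: ok; rewrite /= negbK.
case: k ok => [|k] ok //; rewrite IH1 //.
by move: ok; rewrite !addSn addnS /= negbK.
Qed.

(** A nonzero coefficient of x^k in [P n] has n - k even and sign (-1)^((n - k)/2). The exponent (n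
    + 3k)/2 = (n - k)/2 + 2k has the same parity and avoids truncated subtraction. In the induction
    both terms of the recurrence acquire this sign. *)
Lemma symmetric_coef_sign n k :
  `|(P n)`_k| = (-1) ^+ ((n + 3 * k)./2) * (P n)`_k.
Proof.
suff H m : (forall k, 0 <= (-1) ^+ ((m + 3 * k)./2) * (P m)`_k) /\
      (forall k, 0 <= (-1) ^+ ((m.+1 + 3 * k)./2) * (P m.+1)`_k).
  by have [/(_ k) + _] := H n; move/ger0_norm <-; rewrite normrM normr_sign mul1r.
elim: m {n k} => [|n [IH0 IH1]].
  split=> k.
    rewrite symmetric_coef0; case: k => [|k] /=; last by rewrite mulr0.
    by rewrite mulr1n mul1r ltW.
  rewrite symmetric_coef1; case: k => [|[|k]] /=; rewrite ?mulr0 //.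
  by rewrite mulr1n -[X in _ ^+ X]/2%N sqrrN expr1n mul1r mulr_ge0 ?invr_ge0 // ltW.
split=> // k; rewrite -(pmulr_rge0 _ (b_gt0 n.+1)) mulrCA symmetric_coefSS.
have IHb : 0 <= - ((-1) ^+ ((n.+2 + 3 * k)./2) * (b n * (P n)`_k)).
  by rewrite !addSn /= exprS mulN1r mulNr opprK mulrCA mulr_ge0 // ltW.
rewrite mulrBr addr_ge0 //; case: k {IHb} => [|k]; first by rewrite mulr0.
have -> : ((n.+2 + 3 * k.+1)./2 = 2 + (n.+1 + 3 * k)./2)%N by lia.
by rewrite exprD sqrrN expr1n mul1r.
Qed.

(** The two terms of [symmetric_coefSS] have equal signs once the minus is absorbed, so absolute
    values add without cancellation. *)
Lemma symmetric_abs_coefSS n k :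
  b n.+1 * `|(P n.+2)`_k| =
  (if k is k'.+1 then `|(P n.+1)`_k'| else 0) + b n * `|(P n)`_k|.
Proof.
rewrite !symmetric_coef_sign mulrCA symmetric_coefSS.
rewrite !addSn /= exprS mulN1r mulNr mulrBr opprB addrC mulrCA; congr (_ + _).
case: k => [|k]; first by rewrite mulr0 oppr0.
rewrite symmetric_coef_sign -mulNr; congr (_ * _).
have -> : ((n.+1 + 3 * k)./2 = ((n + 3 * k.+1)./2).-1)%N by lia.
have : (0 < (n + 3 * k.+1)./2)%N by lia.
by case: ((n + _)./2)%N => //= m _; rewrite exprS mulN1r opprK.
Qed.

(** For [P n] this is |P_n(ir)|, the signs of the coefficients compensating the powers of i; it also
    bounds |P_n(z)| on the disc |z| <= r. *)
Definition abs_horner (p : {poly R}) (r : R) : R :=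
  \sum_(k < size p) `|p`_k| * r ^+ k.

Lemma abs_horner_wide (p : {poly R}) m r : (size p <= m)%N ->
  abs_horner p r = \sum_(k < m) `|p`_k| * r ^+ k.
Proof.
move=> pm; rewrite /abs_horner (big_ord_widen m (fun k => `|p`_k| * r ^+ k)) //.
rewrite big_mkcond /=; apply: eq_bigr => i _; case: ltnP => // h.
by rewrite nth_default // normr0 mul0r.
Qed.

Lemma abs_horner_ge0 p r : 0 <= r -> 0 <= abs_horner p r.
Proof. by move=> r0; apply: sumr_ge0 => k _; rewrite mulr_ge0 ?exprn_ge0. Qed.

Lemma abs_horner_rec0 r : r * abs_horner (P 0) r = b 0 * abs_horner (P 1) r.
Proof.
rewrite /abs_horner !size_P !big_ord_recl !big_ord0 /= !symmetric_coef0.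
rewrite !symmetric_coef1 /= mulr0n normr0 mul0r add0r !addr0 !expr0 mulr1.
rewrite mulr1n normrM gtr0_norm ?invr_gt0 // expr1 !mulrA mulfV ?gt_eqF //.
by rewrite mul1r mulrC.
Qed.

Lemma abs_horner_recS n r :
  r * abs_horner (P n.+1) r =
  b n.+1 * abs_horner (P n.+2) r - b n * abs_horner (P n) r.
Proof.
rewrite !(abs_horner_wide (m := n.+3)) ?size_P //; last lia.
rewrite !mulr_sumr; apply/esym/eqP; rewrite subr_eq; apply/eqP.
under eq_bigr do rewrite mulrA symmetric_abs_coefSS mulrDl -mulrA.
rewrite big_split /=; congr (_ + _).
rewrite big_ord_recl mul0r add0r [RHS]big_ord_recr /=.
rewrite nth_default ?size_P // normr0 mul0r mulr0 addr0.
by apply: eq_bigr => i _; rewrite /bump /= exprS mulrCA.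
Qed.

End SymmetricPolynomials.

(** * Linear functionals on polynomials, and reduction modulo x^2 + r^2 *)

Section PolynomialFunctional.
Variables (R : realType) (L : {poly R} -> R).
Hypothesis LD : {morph L : p q / p + q}.
Hypothesis LZ : forall a p, L (a *: p) = a * L p.

Lemma functional_sum N (C : pred 'I_N) (F : 'I_N -> {poly R}) :
  L (\sum_(i < N | C i) F i) = \sum_(i < N | C i) L (F i).
Proof.
by apply: (big_morph L) => //; rewrite -(scale0r 0) LZ mul0r.
Qed.

Lemma orthonormal_norm (P : nat -> {poly R}) N (C : pred 'I_N) (c : nat -> R) :
  (forall m n, L (P m * P n) = (m == n)%:R) ->
  L ((\sum_(i < N | C i) c i *: P i) ^+ 2) = \sum_(i < N | C i) c i ^+ 2.
Proof.
move=> orthP; rewrite expr2 mulr_suml functional_sum; apply: eq_bigr => i Ci.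
rewrite mulr_sumr functional_sum (bigD1 i) //= big1 => [|j /andP[Cj ji]].
  by rewrite addr0 -scalerAl -scalerAr !LZ orthP eqxx mulr1 expr2.
by rewrite -scalerAl -scalerAr !LZ orthP [_ == _](_ : _ = false) ?mulr0 // eq_sym;
  apply/negbTE.
Qed.

Variables (P : nat -> {poly R}) (b : nat -> R) (r : R).
Hypothesis size_P : forall n, size (P n) = n.+1.
Hypothesis lead_P : forall n, 0 < lead_coef (P n).
Hypothesis b_gt0 : forall n, 0 < b n.
Hypothesis rec0 : 'X * P 0 = b 0 *: P 1.
Hypothesis recS : forall n, 'X * P n.+1 = b n.+1 *: P n.+2 + b n *: P n.
Hypothesis r_gt0 : 0 < r.
Hypothesis LX2 : forall q, L ('X^2 * q) = - r ^+ 2 * L q.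

(* Modulo x^2 + r^2 a polynomial reduces to its value at ir, and P_n(ir) is
   i^n times abs_horner (P n) r. *)
Lemma functional_mod n q :
  L (P n * q) = (-1) ^+ (n./2) * abs_horner (P n) r *
                (if odd n then L ('X * q) / r else L q).
Proof.
pose Q m := abs_horner (P m) r; rewrite -/(Q n).
have Q0 : r * Q 0 = b 0 * Q 1 by exact: abs_horner_rec0.
have QS m : r * Q m.+1 = b m.+1 * Q m.+2 - b m * Q m.
  exact: abs_horner_recS.
suff H m : (forall q, L (P m * q) = (-1) ^+ (m./2) * Q m *
     (if odd m then L ('X * q) / r else L q)) /\
    (forall q, L (P m.+1 * q) = (-1) ^+ (m.+1./2) * Q m.+1 *
     (if odd m.+1 then L ('X * q) / r else L q)) by have [/(_ q)] := H n.
have rn0 : r != 0 by rewrite gt_eqF.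
elim: m {n q} => [|n [IH0 IH1]].
  have P0 : P 0 = (lead_coef (P 0))%:P.
    by rewrite {1}(size1_polyC (eq_leq (size_P 0))) lead_coefE size_P.
  have Q0E : Q 0 = lead_coef (P 0).
    rewrite /Q /abs_horner size_P big_ord_recl big_ord0 addr0 expr0 mulr1.
    by have := lead_P 0; rewrite lead_coefE size_P => /gtr0_norm.
  have H0 q : L (P 0 * q) = Q 0 * L q by rewrite P0 mul_polyC LZ Q0E.
  split=> q /=; first by rewrite mul1r.
  have b0 : b 0 != 0 by rewrite gt_eqF.
  apply: (mulfI b0); rewrite -LZ scalerAl -rec0 -['X * _ * _]mulrA ['X * _]mulrCA H0.
  by rewrite mul1r mulrA -Q0; field.
split=> // q; have bn0 : b n.+1 != 0 by rewrite gt_eqF.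
apply: (mulfI bn0).
have -> : b n.+1 * L (P n.+2 * q) = L (P n.+1 * ('X * q)) - b n * L (P n * q).
  apply/esym/eqP; rewrite subr_eq -!LZ -LD !scalerAl -mulrDl -recS.
  by rewrite mulrCA mulrA.
rewrite IH0 IH1 /= negbK mulrA -expr2 LX2.
have e : b n.+1 * Q n.+2 = r * Q n.+1 + b n * Q n by rewrite QS subrK.
rewrite [in RHS]mulrA [in RHS](mulrCA (b _)) e uphalf_half.
by case: (odd n); rewrite /= ?add0n ?add1n ?exprS; field.
Qed.

End PolynomialFunctional.

(** * Integrals of rational functions with poles at ir and -ir *)

Section MomentIntegrals.
Variables (R : realType) (nu : {measure set (measurableTypeR R) -> \bar R}).
Hypothesis nu_moments : has_moments nu.

Lemma integrable_horner (q : {poly R}) :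
  nu.-integrable setT (fun x : measurableTypeR R => (q.[x])%:E).
Proof.
rewrite [X in integrable _ _ X](_ : _ = fun x : measurableTypeR R =>
   (\sum_(k <- iota 0 (size q)) ((q`_k)%:E * (x ^+ k)%:E))%E); last first.
  apply/funext => x; rewrite horner_coef -(big_mkord xpredT
    (fun k => q`_k * x ^+ k)) -sumEFin /index_iota subn0.
  by apply: eq_bigr => k _; rewrite EFinM.
apply: integrable_sum => // k _; exact: integrableZl.
Qed.

Lemma Rintegral_horner (q : {poly R}) :
  \int[nu]_x (q.[x : R]) = \sum_(k < size q) q`_k * moment nu k.
Proof.
rewrite /Rintegral [X in fine X](_ : _ =
   (\sum_(k <- iota 0 (size q)) (q`_k * moment nu k)%:E)%E); last first.
  rewrite (eq_integral (fun x : measurableTypeR R =>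
   (\sum_(k <- iota 0 (size q)) ((q`_k)%:E * (x ^+ k)%:E))%E)); last first.
    move=> x _; rewrite horner_coef -(big_mkord xpredT
      (fun k => q`_k * x ^+ k)) -sumEFin /index_iota subn0.
    by apply: eq_bigr => k _; rewrite EFinM.
  rewrite integral_sum //; last by move=> k; exact: integrableZl.
  apply: eq_bigr => k _; rewrite integralZl // EFinM; congr (_ * _)%E.
  by rewrite /moment /Rintegral fineK //; apply: integrable_fin_num.
by rewrite sumEFin /= -(big_mkord xpredT (fun k => q`_k * moment nu k)) /index_iota subn0.
Qed.

Variable r : R.
Hypothesis r_gt0 : 0 < r.

Definition cauchy_weight (x : R) : R := (x ^+ 2 + r ^+ 2)^-1.

Let den_gt0 (x : R) : 0 < x ^+ 2 + r ^+ 2.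
Proof. by rewrite ltr_wpDl ?sqr_ge0 ?exprn_gt0. Qed.

Lemma measurable_weight k (q : {poly R}) : measurable_fun [set: measurableTypeR R]
  (fun x : measurableTypeR R => cauchy_weight x ^+ k * q.[x]).
Proof.
apply: (@continuous_measurable_fun R) => x; apply: cvgM; last first.
  exact: continuous_horner.
apply: (@continuous_comp _ _ _ cauchy_weight (fun y => y ^+ k)); last first.
  exact: exprn_continuous.
apply: cvgV; first by rewrite gt_eqF.
apply: cvgD; [exact: exprn_continuous|exact: cvg_cst].
Qed.

Lemma weight_ge0 x : 0 <= cauchy_weight x.
Proof. by rewrite invr_ge0 ltW. Qed.

Lemma weight_le x : cauchy_weight x <= (r ^+ 2)^-1.
Proof. by rewrite lef_pV2 ?posrE ?exprn_gt0 // lerDr sqr_ge0. Qed.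

Lemma integrable_weight k (q : {poly R}) : nu.-integrable setT
  (fun x : measurableTypeR R => (cauchy_weight x ^+ k * q.[x])%:E).
Proof.
apply: (le_integrable _ _ _ (integrable_horner ((r ^+ 2)^-1 ^+ k *: q))) => //.
  by apply: measurableT_comp => //; exact: measurable_weight.
move=> x _ /=; rewrite hornerZ !normrM lee_fin ler_wpM2r //.
rewrite !ger0_norm ?exprn_ge0 ?weight_ge0 ?invr_ge0 ?sqr_ge0 //.
by rewrite lerXn2r ?nnegrE ?weight_ge0 ?invr_ge0 ?sqr_ge0 ?weight_le.
Qed.

Definition wint k (q : {poly R}) : R :=
  \int[nu]_x (cauchy_weight (x : R) ^+ k * q.[x : R]).

Lemma wint0 q : wint 0 q = \sum_(k < size q) q`_k * moment nu k.
Proof.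
rewrite -Rintegral_horner; apply: eq_Rintegral => x _.
by rewrite expr0 mul1r.
Qed.

Lemma wintD k : {morph wint k : p q / p + q}.
Proof.
move=> p q; rewrite /wint -RintegralD //; try exact: integrable_weight.
by apply: eq_Rintegral => x _; rewrite hornerD mulrDr.
Qed.

Lemma wintZ k a q : wint k (a *: q) = a * wint k q.
Proof.
rewrite /wint -RintegralZl //; last exact: integrable_weight.
by apply: eq_Rintegral => x _; rewrite hornerZ mulrCA.
Qed.

Lemma wint_reduce k q : wint k.+1 (('X^2 + (r ^+ 2)%:P) * q) = wint k q.
Proof.
apply: eq_Rintegral => x _; rewrite hornerM hornerD hornerXn hornerC.
by rewrite exprSr -mulrA; congr (_ * _); rewrite mulKf // gt_eqF.
Qed.

(** A free parameter t replaces the square roots. All the weight is put on q, so that the term in p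
    is a plain integral, determined by the moments. *)
Lemma wint_cauchy_schwarz k p q t : 0 < t ->
  `|wint k (p * q)| <= (t * wint (k * 2) (q ^+ 2) + wint 0 (p ^+ 2) / t) / 2.
Proof.
move=> t0; have t0' : t != 0 by rewrite gt_eqF.
have iw := integrable_weight.
pose h s x := s * (cauchy_weight x ^+ k * (p * q).[x]).
(* The signs s = 1 and s = -1 together give the absolute value; pointwise, the difference of the two
   sides is a square over 2t. *)
have H (s : R) : s ^+ 2 = 1 ->
    s * wint k (p * q) <=
    (t * wint (k * 2) (q ^+ 2) + wint 0 (p ^+ 2) / t) / 2.
  move=> s1.
  rewrite -[_ / t]mulrC -!wintZ [X in _ <= X]mulrC mulrDr -!wintZ.
  rewrite /wint -RintegralD // -?RintegralZl //; try exact: iw.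
  apply: le_Rintegral => //; try exact: iw.
    apply: eq_integrable (integrableD _ (iw _ _) (iw _ _)) => //.
  move=> x _; rewrite !hornerZ !horner_exp expr0 mul1r exprM.
  set w := cauchy_weight x ^+ k; rewrite hornerM.
  set px := p.[x]; set qx := q.[x].
  rewrite -subr_ge0; suff -> : w ^+ 2 * (2^-1 * (t * qx ^+ 2)) +
    2^-1 * (t^-1 * px ^+ 2) - w * (s * (px * qx)) =
    (2 * t)^-1 * (t * w * qx - s * px) ^+ 2.
    by rewrite mulr_ge0 ?sqr_ge0 // invr_ge0 mulr_ge0 // ltW.
  have -> : (t * w * qx - s * px) ^+ 2 = t ^+ 2 * w ^+ 2 * qx ^+ 2 -
     2 * t * w * qx * s * px + s ^+ 2 * px ^+ 2 by ring.
  by rewrite s1; field.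
rewrite ler_norml lerNl -mulN1r H ?sqrrN ?expr1n //.
by rewrite -[wint _ _]mul1r H // expr1n.
Qed.

End MomentIntegrals.

(** * Comparison of two measures with the same moments *)

Section EqualMoments.
Variables (R : realType) (mu nu : {measure set (measurableTypeR R) -> \bar R}).
Hypotheses (mu_moments : has_moments mu) (nu_moments : has_moments nu).
Hypothesis moment_eq : forall n, moment nu n = moment mu n.
Variables (P : nat -> {poly R}) (b : nat -> R) (r : R).
Hypothesis P_orthonormal : orthonormal_polys mu P.
Hypothesis b_gt0 : forall n, 0 < b n.
Hypothesis rec0 : 'X * P 0 = b 0 *: P 1.
Hypothesis recS : forall n, 'X * P n.+1 = b n.+1 *: P n.+2 + b n *: P n.
Hypothesis r_gt0 : 0 < r.

Let size_P n : size (P n) = n.+1. Proof. by have [] := P_orthonormal. Qed.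
Let lead_P n : 0 < lead_coef (P n). Proof. by have [] := P_orthonormal. Qed.

Definition wdiff k q := wint mu r k q - wint nu r k q.

Lemma wdiffD k : {morph wdiff k : p q / p + q}.
Proof.
by move=> p q; rewrite /wdiff !wintD // opprD addrACA.
Qed.

Lemma wdiffZ k a q : wdiff k (a *: q) = a * wdiff k q.
Proof. by rewrite /wdiff !wintZ // mulrBr. Qed.

Lemma wint0_moment_eq q : wint nu r 0 q = wint mu r 0 q.
Proof. by rewrite !wint0 //; apply: eq_bigr => k _; rewrite moment_eq. Qed.

(** A factor x^2 + r^2 cancels one weight and leads back to exponent k, where the two measures
    agree. *)
Lemma wdiff_reduce k : (forall q, wdiff k q = 0) ->
  forall q, wdiff k.+1 ('X^2 * q) = - r ^+ 2 * wdiff k.+1 q.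
Proof.
move=> k0 q; apply/eqP; rewrite mulNr -addr_eq0 -wdiffZ -wdiffD.
by rewrite -mul_polyC -mulrDl /wdiff !wint_reduce // -/(wdiff k q) k0.
Qed.

(** Here [e] is a parity class of n. By [functional_mod], the functional at [P n * q] is [c n] times
    a value v common to the whole class, so the combination of the [P n] with coefficients [c n]
    yields T v. *)
Lemma wdiff_neq0_bounded k q (e : bool) : (forall q, wdiff k q = 0) ->
  (if e then wdiff k.+1 ('X * q) / r else wdiff k.+1 q) != 0 ->
  exists C, forall N, \sum_(n < N | odd n == e) abs_horner (P n) r ^+ 2 <= C.
Proof.
move=> k0; set v := (if e then _ else _) => v0.
pose G := (wint mu r (k.+1 * 2) (q ^+ 2) + wint nu r (k.+1 * 2) (q ^+ 2)) / 2.
exists (4 * G / v ^+ 2) => N; set T := \sum_(n < N | _) _.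
pose c n := (-1) ^+ (n./2) * abs_horner (P n) r.
pose p := \sum_(n < N | odd n == e) c n *: P n.
have cT : \sum_(n < N | odd n == e) c n ^+ 2 = T.
  by apply: eq_bigr => n _; rewrite exprMn sqrr_sign mul1r.
have pT : wint mu r 0 (p ^+ 2) = T.
  rewrite (orthonormal_norm (wintD mu_moments r_gt0 0) (wintZ mu_moments r_gt0 0)) //.
  move=> m n; have [_ _ <-] := P_orthonormal.
  by apply: eq_Rintegral => x _; rewrite expr0 mul1r hornerM.
have pTnu : wint nu r 0 (p ^+ 2) = T by rewrite wint0_moment_eq.
have LT : wdiff k.+1 (p * q) = T * v.
  rewrite /p mulr_suml (functional_sum (wdiffD k.+1) (wdiffZ k.+1)) -cT mulr_suml.
  apply: eq_bigr => n /eqP ne; rewrite -scalerAl wdiffZ.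
  rewrite (functional_mod (wdiffD k.+1) (wdiffZ k.+1) size_P lead_P b_gt0
    rec0 recS r_gt0); last first.
    exact: wdiff_reduce.
  by rewrite ne mulrA -expr2.
have T0 : 0 <= T by apply: sumr_ge0 => n _; exact: sqr_ge0.
have bound t : 0 < t -> T * `|v| <= t * G + T / t.
  move=> t0; rewrite -[T in T * _]ger0_norm // -normrM -LT.
  rewrite /wdiff (le_trans (ler_normB _ _)) //.
  have := wint_cauchy_schwarz mu_moments r_gt0 k.+1 p q t0.
  have := wint_cauchy_schwarz nu_moments r_gt0 k.+1 p q t0.
  rewrite pT pTnu /G; lra.
clearbody G; have v0' : 0 < `|v| by rewrite normr_gt0.
(* With t = 2 / |v| the term T / t is half of the left-hand side; absorbing it leaves T v^2 <= 4
   G. *)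
have := bound (2 / `|v|); rewrite divr_gt0 // => /(_ isT).
rewrite ler_pdivlMr ?exprn_even_gt0 // -[v ^+ 2]real_normK ?num_real //.
move: `|v| v0' => w w0; have wn0 : w != 0 by rewrite gt_eqF.
rewrite invf_div mulrA => h.
have : T * w / 2 * w * 2 <= 2 / w * G * w * 2.
  by rewrite !ler_pM2r //; lra.
by rewrite (_ : 2 / w * G * w * 2 = 4 * G); [rewrite expr2; lra|field].
Qed.

Lemma wdiff0_unbounded :
  ~ (exists C, forall N, \sum_(n < N) abs_horner (P n) r ^+ 2 <= C) ->
  forall k q, wdiff k q = 0.
Proof.
move=> unbounded; elim=> [|k IH] q.
  by rewrite /wdiff wint0_moment_eq subrr.
apply/eqP/negP => /negP q0; apply: unbounded.
have [C0 HC0] := @wdiff_neq0_bounded k q false IH q0.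
(* For odd n the test polynomial is x q: the value to be nonzero is then that of x^2 q over r, which
   is -r times that of q. *)
have [|C1 HC1] := @wdiff_neq0_bounded k ('X * q) true IH.
  have rn0 : r != 0 by rewrite gt_eqF.
  rewrite mulrA -expr2 wdiff_reduce //; apply: mulf_neq0; last by rewrite invr_eq0.
  by apply: mulf_neq0 => //; rewrite oppr_eq0 expf_neq0.
exists (C1 + C0) => N; rewrite (bigID (fun n : 'I_N => odd n)) /= lerD //.
  rewrite (le_trans _ (HC1 N)) // le_eqVlt.
  by under [eqbRHS]eq_bigl do rewrite eqb_id; rewrite eqxx.
rewrite (le_trans _ (HC0 N)) // le_eqVlt.
by under [eqbRHS]eq_bigl do rewrite eqbF_neg; rewrite eqxx.
Qed.

End EqualMoments.

(** * Determination of a measure by the weighted integrals *)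

Section StepApproximation.
Variable R : realType.
Implicit Types (y z : R).

Lemma bernoulli_le y k : 0 <= y <= 1 -> 1 - k%:R * y <= (1 - y) ^+ k.
Proof.
move=> /andP[y0 y1]; elim: k => [|k IH]; first by rewrite mul0r subr0 expr0.
rewrite exprS; apply: (@le_trans _ _ ((1 - y) * (1 - k%:R * y))).
  have : 0 <= k%:R * y ^+ 2 :> R by rewrite mulr_ge0 ?ler0n ?sqr_ge0.
  by rewrite -natr1 expr2; lra.
by rewrite ler_wpM2l ?subr_ge0.
Qed.

Lemma expr_le_inv y k : 0 <= y <= 1 -> (1 - y) ^+ k <= (1 + k%:R * y)^-1.
Proof.
move=> /andP[y0 y1]; have ky : 0 < 1 + k%:R * y.
  by rewrite ltr_pwDl // mulr_ge0 ?ler0n.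
rewrite -[X in _ <= X]mul1r ler_pdivlMr //.
elim: k {ky} => [|k IH]; first by rewrite mul0r addr0 expr0 mulr1.
rewrite exprSr -mulrA; apply: le_trans IH.
rewrite ler_wpM2l ?exprn_ge0 ?subr_ge0 //.
have : 0 <= k%:R * y ^+ 2 :> R by rewrite mulr_ge0 ?ler0n ?sqr_ge0.
have := sqr_ge0 y; rewrite -natr1 !expr2; lra.
Qed.

(** In 1 - z^n = (1 - z)(1 + z + ... + z^(n-1)) each of the n summands is at least z^n. *)
Lemma natmul_expr_bound z n : 0 <= z <= 1 -> n%:R * (1 - z) * z ^+ n <= 1 - z ^+ n.
Proof.
move=> /andP[z0 z1]; elim: n => [|n IH]; first by rewrite !mul0r expr0 subrr.
have : 0 <= (1 - z) * (1 - z ^+ n.+1).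
  by rewrite mulr_ge0 ?subr_ge0 ?exprn_ile1.
have := ler_wpM2l z0 IH; rewrite -natr1 exprS.
move: (z ^+ n) n%:R => a c; lra.
Qed.

(** Writing z = w^2, the previous bound gives n w^n <= 1 / (1 - w), and the other factor w^n tends
    to 0. *)
Lemma cvg_natmul_expr z : 0 <= z < 1 -> (n%:R * z ^+ n) @[n --> \oo] --> (0 : R).
Proof.
move=> /andP[z0 z1]; set w := Num.sqrt z.
have w0 : 0 <= w by exact: sqrtr_ge0.
have w1 : w < 1 by rewrite -sqrtr1 ltr_sqrt.
have wz : z = w ^+ 2 by rewrite sqr_sqrtr.
have c0 : (1 - w)^-1 * w ^+ n @[n --> \oo] --> (0 : R).
  rewrite -[X in _ --> X](mulr0 (1 - w)^-1); apply: cvgMr.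
  by apply: cvg_expr; rewrite ger0_norm.
apply: (squeeze_cvgr _ (cvg_cst 0) c0); near=> n.
rewrite mulr_ge0 ?exprn_ge0 //= wz exprAC expr2 mulrA ler_wpM2r ?exprn_ge0 //.
rewrite -[X in _ <= X]mul1r ler_pdivlMr ?subr_gt0 // mulrAC.
apply: le_trans (natmul_expr_bound _ _) _; first by rewrite w0 ltW.
by rewrite gerBl exprn_ge0.
Unshelve. all: by end_near. Qed.

(* Tends to the indicator of [0, 1/2[: n (2 y)^n -> 0 for y < 1/2, while
   (1 - 2^-n)^(n 2^n) <= 1 / (n + 1). *)
Definition step_approx n y := (1 - y ^+ n) ^+ (n * 2 ^ n).

Lemma step_approx_bound n y : 0 <= y <= 1 -> 0 <= step_approx n y <= 1.
Proof.
move=> /andP[y0 y1]; have yn : 0 <= 1 - y ^+ n by rewrite subr_ge0 exprn_ile1.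
by rewrite exprn_ge0 //= exprn_ile1 // gerBl exprn_ge0.
Qed.

Lemma cvg_step_approx y : 0 <= y <= 1 ->
  step_approx n y @[n --> \oo] --> ((y < 2^-1)%R%:R : R).
Proof.
move=> y01; have /andP[y0 y1] := y01; case: ltP => yh.
  have c1 : 1 - n%:R * (2 * y) ^+ n @[n --> \oo] --> (1 : R).
    rewrite -[X in _ --> X]subr0; apply: cvgB; first exact: cvg_cst.
    by apply: cvg_natmul_expr; rewrite mulr_ge0 //=; lra.
  apply: (squeeze_cvgr _ c1 (cvg_cst _)); near=> n.
  have /andP[_ ->] := step_approx_bound n y01; rewrite andbT.
  apply: le_trans (bernoulli_le _ _); last by rewrite exprn_ge0 // exprn_ile1.
  by rewrite natrM natrX exprMn mulrA.
have c1 : (1 + n%:R)^-1 @[n --> \oo] --> (0 : R).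
  by under eq_fun do rewrite nat1r; apply: cvg_harmonic.
apply: (squeeze_cvgr _ (cvg_cst 0) c1); near=> n.
have /andP[-> _] := step_approx_bound n y01.
have h01 : 0 <= (2^-1 : R) ^+ n <= 1.
  by rewrite exprn_ge0 ?invr_ge0 ?ler0n //= exprn_ile1 ?invr_ge0 ?ler0n //; lra.
(* [step_approx n] decreases in y, so the case y = 1/2 is the worst one. *)
apply: le_trans (_ : (1 - 2^-1 ^+ n) ^+ (n * 2 ^ n) <= _).
  have hy : (2^-1 : R) ^+ n <= y ^+ n by rewrite lerXn2r ?nnegrE ?invr_ge0 ?ler0n.
  by rewrite lerXn2r ?nnegrE ?subr_ge0 ?lerB ?exprn_ile1 //; lra.
apply: le_trans (expr_le_inv _ h01) _.
by rewrite natrM natrX -mulrA exprVn mulfV ?mulr1 // expf_neq0.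
Unshelve. all: by end_near. Qed.

End StepApproximation.

(** * From weighted integrals to half-lines and Borel sets *)

Section WeightedIntegralsDetermine.
Variables (R : realType) (mu nu : {measure set (measurableTypeR R) -> \bar R}).
Hypotheses (mu_moments : has_moments mu) (nu_moments : has_moments nu).
Variable r : R.
Hypothesis r_gt0 : 0 < r.
Hypothesis wint_eq : forall k q, wint nu r k q = wint mu r k q.

Let den_gt0 (x : R) : 0 < x ^+ 2 + r ^+ 2.
Proof. by rewrite ltr_wpDl ?sqr_ge0 ?exprn_gt0. Qed.

(** Times the weight, this is 1/2 + (x - a) / (2 M (x^2 + r^2)). Since |x| / (x^2 + r^2) <= 1 / r
    and |a| / (x^2 + r^2) <= |a| / r^2, the constant M keeps it in [0, 1]; it is below 1/2 exactly
    for x < a. *)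
Definition shifted_weight a : {poly R} :=
  let M := r^-1 + `|a| / r ^+ 2 in
  (2 * M)^-1 *: (M *: ('X^2 + (r ^+ 2)%:P) + ('X - a%:P)).

Lemma shifted_weight_bound a x :
  0 <= cauchy_weight r x * (shifted_weight a).[x] <= 1 /\
  (cauchy_weight r x * (shifted_weight a).[x] < 2^-1) = (x < a).
Proof.
rewrite /shifted_weight; set M := _ + _.
have M0 : 0 < M.
  by rewrite ltr_pwDl ?invr_gt0 // mulr_ge0 // invr_ge0 exprn_ge0 // ltW.
rewrite !(hornerZ, hornerD, hornerN, hornerX, hornerXn, hornerC).
rewrite /cauchy_weight; set d := x ^+ 2 + r ^+ 2.
have d0 : 0 < d by exact: den_gt0.
have xa : `|x - a| <= M * d.
  apply: le_trans (ler_normB _ _) _; rewrite mulrDl lerD //.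
    rewrite ler_pdivlMl // -subr_ge0 /d -[x ^+ 2]real_normK ?num_real //.
    have := sqr_ge0 (`|x| - r); have := sqr_ge0 `|x|; have := sqr_ge0 r.
    rewrite !expr2; lra.
  rewrite -mulrA ler_peMr // ler_pdivlMl ?exprn_gt0 // mulr1.
  by rewrite lerDr sqr_ge0.
have -> : d^-1 * ((2 * M)^-1 * (M * d + (x - a))) =
   2^-1 + (x - a) / (2 * M * d).
  by field; rewrite !gt_eqF.
have Md : 0 < 2 * M * d by rewrite !mulr_gt0.
move: xa; rewrite ler_norml => /andP[xa1 xa2]; split.
  have h1 : (x - a) / (2 * M * d) <= 2^-1 by rewrite ler_pdivrMr //; lra.
  have h2 : - 2^-1 <= (x - a) / (2 * M * d) by rewrite ler_pdivlMr //; lra.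
  by apply/andP; split; lra.
by rewrite -subr_gt0 opprD addNKr oppr_gt0 pmulr_llt0 ?invr_gt0 // subr_lt0.
Qed.

(** Each of the n 2^n outer factors absorbs n weights, turning (x^2 + r^2)^n into 1; the integrand
    becomes [step_approx n (phi x)]. *)
Lemma cvg_wint_step (rho : {measure set (measurableTypeR R) -> \bar R}) a :
  has_moments rho ->
  (wint rho r (n * (n * 2 ^ n))
    ((('X^2 + (r ^+ 2)%:P) ^+ n - shifted_weight a ^+ n) ^+ (n * 2 ^ n)))%:E
    @[n --> \oo] --> rho `]-oo, a[%classic.
Proof.
move=> rho_moments.
pose phi (x : R) := cauchy_weight r x * (shifted_weight a).[x].
pose f n (x : measurableTypeR R) := (cauchy_weight r x ^+ (n * (n * 2 ^ n)) *
   ((('X^2 + (r ^+ 2)%:P) ^+ n - shifted_weight a ^+ n) ^+ (n * 2 ^ n)).[x])%:E.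
have fE n x : f n x = (step_approx n (phi x))%:E.
  rewrite /f /step_approx /phi horner_exp hornerD hornerN !horner_exp.
  rewrite hornerD hornerXn hornerC exprM -exprMn mulrBr -!exprMn.
  by rewrite [X in X ^+ n - _]mulVf ?expr1n // gt_eqF.
have fint n : rho.-integrable setT (f n) by exact: integrable_weight.
have -> : rho `]-oo, a[%classic = (\int[rho]_x (\1_(`]-oo, a[%classic) x)%:E)%E.
  by rewrite integral_indic // setIT.
rewrite [X in X @ _](_ : _ = fun n => (\int[rho]_x f n x)%E); last first.
  apply/funext => n; rewrite /wint /Rintegral fineK //.
  exact: (integrable_fin_num _ (fint n)).
(* The dominating constant 1 is written x^0, whose integrability is the moment condition of order
   0. *)
apply: (@dominated_cvg _ _ _ _ setT _ f _ (fun x => (x ^+ 0)%:E)) => //.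
- by move=> n; exact: measurable_int (fint n).
- move=> x _; under eq_fun do rewrite fE.
  have [b1 b2] := shifted_weight_bound a x.
  apply: cvg_EFin; first exact: nearW.
  rewrite [X in _ --> X](_ : _ = (phi x < 2^-1)%R%:R); first exact: cvg_step_approx.
  by rewrite b2 indicE /=; congr (_%:R); apply: congr1; rewrite mem_setE in_itv.
- move=> n x _; rewrite fE expr0 lee_fin.
  have [/(step_approx_bound n)/andP[h0 h1] _] := shifted_weight_bound a x.
  by rewrite ger0_norm.
Qed.

(** Open half-lines are stable under intersection, generate the Borel sets and exhaust the line with
    finite measure. *)
Lemma measure_eq_of_wint A : measurable A -> nu A = mu A.
Proof.
have half_line a : nu `]-oo, a[%classic = mu `]-oo, a[%classic.
  have := cvg_wint_step (a := a) nu_moments.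
  under eq_fun do rewrite wint_eq.
  move=> nu_step.
  have mu_step := cvg_wint_step (a := a) mu_moments.
  exact: (cvg_unique (@ereal_hausdorff R) nu_step mu_step).
move=> mA; have mA' : <<s @RGenInftyO.G R >> A.
  have : (@RGenInftyO.G R).-sigma.-measurable A.
    by rewrite -RGenInftyO.measurableE; exact: mA.
  by [].
apply: (@g_sigma_algebra_measure_unique _ R (measurableTypeR R)
   (@RGenInftyO.G R) _ (fun n => `]-oo, n%:R[%classic) _ _ nu mu _ _ _ A mA').
- by move=> _ [x ->]; exact: measurable_itv.
- by move=> i; exists i%:R.
- apply/seteqP; split=> // x _; exists (Num.bound `|x|) => //=.
  by rewrite in_itv /= (le_lt_trans (ler_norm _)) // archi_boundP.
- move=> _ _ [x ->] [y ->]; exists (Num.min x y); apply/seteqP; split=> z /=.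
    by rewrite !in_itv /= lt_min => -[-> ->].
  by rewrite !in_itv /= lt_min => /andP.
- by move=> _ [x ->]; exact: half_line.
- move=> n; apply: (@le_lt_trans _ _ (nu setT)); first by rewrite le_measure ?inE.
  have /integrableP[_] := nu_moments 0%N.
  under eq_integral do rewrite expr0 /= normr1.
  by rewrite integral_cst // mul1e.
Qed.

End WeightedIntegralsDetermine.

(** * The matrix of kernel coefficients *)

Section IndeterminateBound.
Variables (R : realType) (mu : {measure set (measurableTypeR R) -> \bar R}).
Variable P : nat -> {poly R}.
Hypotheses (mu_moments : has_moments mu) (P_orthonormal : orthonormal_polys mu P).
Hypotheses (P_symmetric : symmetric_recurrence P) (mu_indet : indeterminate mu).

Lemma indeterminate_abs_horner_bounded r : 0 < r ->
  exists C, forall N, \sum_(n < N) abs_horner (P n) r ^+ 2 <= C.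
Proof.
move=> r0; apply: contrapT => unbounded.
have [b [b0 rec0 recS]] := P_symmetric.
have [nu [nu_moments moment_eq [A mA]]] := mu_indet; apply.
apply: (measure_eq_of_wint mu_moments nu_moments r0) => // k q.
apply/eqP; rewrite eq_sym -subr_eq0; apply/eqP.
exact: (wdiff0_unbounded mu_moments nu_moments moment_eq P_orthonormal b0).
Qed.

End IndeterminateBound.

Section OrthonormalExpansion.
Variables (R : realType) (L : {poly R} -> R).
Hypothesis LD : {morph L : p q / p + q}.
Hypothesis LZ : forall a p, L (a *: p) = a * L p.
Variable P : nat -> {poly R}.
Hypothesis size_P : forall n, size (P n) = n.+1.
Hypothesis orthP : forall m n, L (P m * P n) = (m == n)%:R.

(** Subtracting c P_M, with c the quotient of the coefficients of x^M, lowers the degree. By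
    induction the remainder is a combination of earlier P_n, hence orthogonal to P_M, so c = L(P_M
    q). *)
Lemma orthonormal_expansion M (q : {poly R}) : (size q <= M)%N ->
  q = \sum_(n < M) L (P n * q) *: P n.
Proof.
elim: M q => [|M IH] q.
  by rewrite leqn0 size_poly_eq0 => /eqP ->; rewrite big_ord0.
move=> qM; pose c := q`_M / (P M)`_M; pose q' := q - c *: P M.
have PM0 : (P M)`_M != 0.
  rewrite -[M in _`_M]/(M.+1.-1) -size_P -lead_coefE lead_coef_eq0.
  by rewrite -size_poly_eq0 size_P.
have q'M : (size q' <= M)%N.
  apply/leq_sizeP => j; rewrite leq_eqVlt => /predU1P[<-|Mj].
    by rewrite coefB coefZ divfK // subrr.
  rewrite coefB coefZ !nth_default ?size_P //; last exact: leq_trans Mj.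
  by rewrite mulr0 subrr.
have qE : q = c *: P M + q' by rewrite addrC subrK.
have Lq' n : L (P n * q) = c * (n == M)%:R + L (P n * q').
  by rewrite {1}qE mulrDr LD -scalerAr LZ orthP.
have LM : L (P M * q') = 0.
  rewrite (IH _ q'M) mulr_sumr (functional_sum LD LZ) big1 // => i _.
  by rewrite -scalerAr LZ orthP [_ == _]gtn_eqF ?mulr0.
rewrite big_ord_recr /= Lq' eqxx LM mulr1 addr0 {1}qE addrC; congr (_ + _).
rewrite {1}(IH _ q'M); apply: eq_bigr => i _.
by rewrite Lq' [_ == _]ltn_eqF ?mulr0 ?add0r.
Qed.

End OrthonormalExpansion.

Lemma cvg_bigsum (K : numFieldType) (V : normedModType K) (I : Type) (s : seq I)
    (f : I -> nat -> V) (l : I -> V) :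
  (forall i, f i @ \oo --> l i) ->
  (fun n => \sum_(i <- s) f i n) @ \oo --> \sum_(i <- s) l i.
Proof.
move=> fl; elim: s => [|i s IH].
  rewrite big_nil; under eq_fun do rewrite big_nil; exact: cvg_cst.
by rewrite big_cons; under eq_fun do rewrite big_cons; exact: cvgD.
Qed.

(** * The series for a_(j,k), its truncations and the moment sums *)

Section CoefficientMatrix.
Variables (R : realType) (P : nat -> {poly R}).
Hypothesis size_P : forall n, size (P n) = n.+1.
Hypothesis P_bounded : forall r, 0 < r ->
  exists C, forall N, \sum_(n < N) abs_horner (P n) r ^+ 2 <= C.

(** The explicit series for a_(j,k); terms with n < max(j, k) vanish by degree. [kernel_coef] is
    identified with it by [kernel_coefE]. *)
Definition kernel_matrix j k : R :=
  limn (series (fun n => (P n)`_j * (P n)`_k)).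

Lemma coef_le_abs_horner (p : {poly R}) j r : 0 <= r ->
  `|p`_j| * r ^+ j <= abs_horner p r.
Proof.
move=> r0; case: (ltnP j (size p)) => jp; last first.
  by rewrite nth_default // normr0 mul0r abs_horner_ge0.
rewrite /abs_horner (bigD1 (Ordinal jp)) //= lerDl.
by apply: sumr_ge0 => k _; rewrite mulr_ge0 ?exprn_ge0.
Qed.

Lemma cvg_abs_horner_sq r : 0 < r ->
  cvgn (series (fun n => abs_horner (P n) r ^+ 2)).
Proof.
move=> r0; have [C HC] := P_bounded r0.
apply: nondecreasing_is_cvgn.
  by apply: nondecreasing_series => n _ _; exact: sqr_ge0.
by exists C => _ [N _ <-]; rewrite seriesEord /=; exact: HC.
Qed.

Lemma is_cvg_normed_coef j k :
  cvgn [normed series (fun n => (P n)`_j * (P n)`_k)].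
Proof.
apply: (series_le_cvg _ _ _ (cvg_abs_horner_sq ltr01)) => [n|n|n].
- exact: normr_ge0.
- exact: sqr_ge0.
- rewrite /= normrM expr2; apply: ler_pM => //.
    by have := coef_le_abs_horner (P n) j ler01; rewrite expr1n mulr1.
  by have := coef_le_abs_horner (P n) k ler01; rewrite expr1n mulr1.
Qed.

Lemma cvg_kernel_matrix j k :
  series (fun n => (P n)`_j * (P n)`_k) @ \oo --> kernel_matrix j k.
Proof. exact: (normed_cvg (@is_cvg_normed_coef j k)). Qed.

Variables (b : nat -> R).
Hypothesis lead_P : forall n, 0 < lead_coef (P n).
Hypothesis b_gt0 : forall n, 0 < b n.
Hypothesis rec0 : 'X * P 0 = b 0 *: P 1.
Hypothesis recS : forall n, 'X * P n.+1 = b n.+1 *: P n.+2 + b n *: P n.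

(** The sign does not depend on n: in a nonzero product n, i and k have the same parity, and (n +
    3i)/2 + (n + 3k)/2 = n + 3(i + k)/2, where n may be replaced by i. *)
Lemma coef_mul_sign i k n :
  (P n)`_i * (P n)`_k =
  (-1) ^+ (i + (3 * (i + k))./2) * `|(P n)`_i * (P n)`_k|.
Proof.
rewrite normrM !(symmetric_coef_sign size_P lead_P b_gt0 rec0 recS).
have odd0 := symmetric_coef_odd size_P b_gt0 rec0 recS.
case: (boolP (odd (n + i))) => [/odd0 ->|ni]; first by rewrite mulr0 !mul0r mulr0.
case: (boolP (odd (n + k))) => [/odd0 ->|nk]; first by rewrite !mulr0.
rewrite mulrACA -exprD !mulrA -exprD.
set e := (_ + _)%N; have : ~~ odd e by rewrite /e; lia.
by move=> he; rewrite -signr_odd (negbTE he) expr0 mul1r.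
Qed.

(** As the terms share one sign, the absolute values of the partial sums are partial sums of
    absolute values, hence nondecreasing in M. *)
Lemma partial_kernel_matrix_le i k M :
  `|\sum_(n < M) (P n)`_i * (P n)`_k| <= `|kernel_matrix i k|.
Proof.
have nE N : `|\sum_(n < N) (P n)`_i * (P n)`_k| =
    [normed series (fun n => (P n)`_i * (P n)`_k)] N.
  rewrite /= seriesEord /=; under eq_bigr do rewrite coef_mul_sign.
  rewrite -mulr_sumr normrM normr_sign mul1r ger0_norm //.
  by apply: sumr_ge0.
rewrite nE; have := cvg_norm (@cvg_kernel_matrix i k).
rewrite (_ : (fun x => _) = [normed series (fun n => (P n)`_i * (P n)`_k)]); last first.
  by apply/funext => N; rewrite -nE seriesEord /=.
move=> /(_ _) h; rewrite -(cvg_lim (@Rhausdorff R) h).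
apply: nondecreasing_cvgn_le; last exact: is_cvg_normed_coef.
by apply: nondecreasing_series => n _ _; exact: normr_ge0.
Qed.

Variable mu : {measure set (measurableTypeR R) -> \bar R}.
Hypotheses (mu_moments : has_moments mu) (P_orthonormal : orthonormal_polys mu P).

(** Both sides are the coefficient of x^i in the expansion of x^j along P_0, ..., P_(M-1), which is
    exact for j < M. *)
Lemma partial_kernel_moment_sum i j M : (j < M)%N ->
  \sum_(k < M) (\sum_(n < M) (P n)`_i * (P n)`_k) * moment mu (k + j) =
  (i == j)%:R.
Proof.
move=> jM; pose L := wint mu 1 0.
have LD : {morph L : p q / p + q} by exact: wintD.
have LZ a p : L (a *: p) = a * L p by exact: wintZ.
have orthP m n : L (P m * P n) = (m == n)%:R.
  have [_ _ <-] := P_orthonormal.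
  by apply: eq_Rintegral => x _; rewrite expr0 mul1r hornerM.
have LX m : L 'X^m = moment mu m.
  by apply: eq_Rintegral => x _; rewrite expr0 mul1r hornerXn.
have := orthonormal_expansion LD LZ size_P orthP (_ : size 'X^j <= M)%N.
rewrite size_polyXn => /(_ jM) /(congr1 (fun p : {poly R} => p`_i)).
rewrite coefXn => ->; rewrite coef_sum.
under eq_bigr do rewrite mulr_suml.
rewrite exchange_big /=; apply: eq_bigr => n _; rewrite coefZ [RHS]mulrC.
under eq_bigr do rewrite -mulrA; rewrite -mulr_sumr; congr (_ * _).
(* Expanding P_n in monomials turns L(P_n x^j) into a sum of moments, padded below with zero
   coefficients up to k < M. *)
rewrite -[in RHS](coefK (P n)) poly_def size_P mulr_suml (functional_sum LD LZ).
rewrite [RHS](big_ord_widen M (fun k => L ((P n)`_k *: 'X^k * 'X^j))) //.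
rewrite [RHS]big_mkcond; apply: eq_bigr => k _ /=.
case: ifP => nk; first by rewrite -scalerAl LZ -exprD LX.
by rewrite nth_default ?mul0r // size_P leqNgt nk.
Qed.

Lemma kernel_moment_series i j :
  cvgn [normed series (fun k => kernel_matrix i k * moment mu (k + j))] ->
  series (fun k => kernel_matrix i k * moment mu (k + j)) @ \oo
    --> ((i == j)%:R : R).
Proof.
set s := fun k => _; move=> cs.
have ge0 : nondecreasing_seq [normed series s].
  by apply: nondecreasing_series => n _ _; exact: normr_ge0.
pose Y := limn [normed series s].
pose AM M k := \sum_(n < M) (P n)`_i * (P n)`_k.
have AMc k : AM ^~ k @ \oo --> kernel_matrix i k.
  by have := @cvg_kernel_matrix i k; rewrite seriesEord.
(* For M > j and M >= N, delta_(i,j) is the truncated sum over k < M; its first N terms cancel and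
   the others are dominated by |s k|. Then M tends to infinity with N fixed. *)
have tail N : `|(i == j)%:R - series s N| <= Y - [normed series s] N.
  have c1 : (fun M => `|(i == j)%:R - \sum_(k < N) AM M k * moment mu (k + j)|)
      @ \oo --> `|(i == j)%:R - series s N|.
    apply: cvg_norm; apply: cvgB; first exact: cvg_cst.
    rewrite seriesEord; apply: cvg_bigsum => k; apply: cvgMl; exact: AMc.
  rewrite -(cvg_lim (@Rhausdorff R) c1).
  apply: limr_le; first by apply: cvgP c1.
  near=> M.
  have jM : (j < M)%N by near: M; exact: nbhs_infty_gt.
  have NM : (N <= M)%N by near: M; exact: nbhs_infty_ge.
  rewrite -(partial_kernel_moment_sum i jM) -/(AM M).
  rewrite -!(big_mkord xpredT (fun k => AM M k * moment mu (k + j))).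
  rewrite (big_cat_nat (leq0n _) NM) //= addrAC subrr add0r.
  apply: le_trans (ler_norm_sum _ _ _) _.
  apply: (@le_trans _ _ (\sum_(N <= k < M) `|s k|)).
    apply: ler_sum => k _; rewrite !normrM ler_wpM2r //.
    exact: partial_kernel_matrix_le.
  have -> : \sum_(N <= k < M) `|s k| = [normed series s] M - [normed series s] N.
    by rewrite /= /series /= [in RHS](big_cat_nat (leq0n _) NM) //= addrAC subrr add0r.
  by rewrite lerB //; apply: nondecreasing_cvgn_le.
have c0 : (fun N => Y - [normed series s] N) @ \oo --> (0 : R).
  by rewrite -[X in _ --> X](subrr Y); apply: cvgB => //; exact: cvg_cst.
apply/cvgrPdist_le => e e0; near=> N.
apply: le_trans (tail N) _; apply: le_trans (ler_norm _) _.
by near: N; exact: (cvgr0_norm_le _ c0).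
Unshelve. all: by end_near. Qed.

End CoefficientMatrix.

(** * Complex norm and double series *)

Section ComplexNorm.
Variable R : realType.
Implicit Types z w : R[i].

Lemma norm_normc z : `|z| = (normc z)%:C%C.
Proof. by []. Qed.

Lemma normcD z w : normc (z + w) <= normc z + normc w.
Proof. exact: le_normcD. Qed.

Lemma normc_ge0 z : 0 <= normc z.
Proof. by case: z => a b; exact: sqrtr_ge0. Qed.

Lemma normc_opp z : normc (- z) = normc z.
Proof. exact: normcN. Qed.

Lemma normcX z n : normc (z ^+ n) = normc z ^+ n.
Proof.
elim: n => [|n IH]; first by rewrite !expr0 ComplexField.Normc.normc1.
by rewrite !exprS ComplexField.Normc.normcM IH.
Qed.

Lemma normc_real (x : R) : normc x%:C%C = `|x|.
Proof. by rewrite /= expr0n addr0 sqrtr_sqr. Qed.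

Lemma normc_sum_le N (F : 'I_N -> R[i]) (G : 'I_N -> R) :
  (forall i, normc (F i) <= G i) ->
  normc (\sum_(i < N) F i) <= \sum_(i < N) G i.
Proof.
move=> FG; elim/big_rec2: _ => [|i y x _ xy]; first by rewrite ComplexField.Normc.normc0.
by rewrite (le_trans (normcD _ _)) // lerD.
Qed.

(** The norm of [R[i]] and its epsilons are themselves complex; a positive element has zero
    imaginary part, so real epsilons suffice. *)
Lemma cvg_normcP (u : nat -> R[i]^o) (l : R[i]^o) :
  u @ \oo --> l <->
  forall e : R, 0 < e -> \forall n \near \oo, normc (l - u n) <= e.
Proof.
split=> [/cvgrPdist_le ul e e0|H].
  have /ul : 0 < e%:C%C by rewrite ltcR.
  by apply: filterS => n; rewrite norm_normc lecR.
apply/cvgrPdist_le => e; case: e => a b.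
rewrite ltcE /= => /andP[/eqP -> a0].
by apply: filterS (H _ a0) => n; rewrite norm_normc lecR.
Qed.

Lemma normc_lim_le (u : nat -> R[i]^o) (l : R[i]^o) B :
  u @ \oo --> l -> (\forall n \near \oo, normc (u n) <= B) -> normc l <= B.
Proof.
move=> /cvg_normcP ul uB; apply/ler_addgt0Pr => e e0.
have [n [un1 un2]] : exists n, normc (l - u n) <= e /\ normc (u n) <= B.
  by apply: (@filter_ex _ (nbhs \oo)); apply: filterI; [exact: ul|].
rewrite -(subrK (u n) l) (le_trans (normcD _ _)) // addrC lerD //.
Qed.

Lemma cvg_real_complex (u : R^nat) (l : R) : u @ \oo --> l ->
  (fun n => (u n)%:C%C : R[i]^o) @ \oo --> (l%:C%C : R[i]^o).
Proof.
move=> /cvgrPdist_le ul; apply/cvg_normcP => e /ul; apply: filterS => n.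
by rewrite -rmorphB normc_real.
Qed.

(** Real and imaginary parts are both dominated by the modulus, hence converge absolutely over
    [R]. *)
Lemma normc_series_cvg (u : nat -> R[i]^o) (v : R^nat) :
  (forall n, normc (u n) <= v n) -> cvgn (series v) ->
  exists l : R[i]^o, series u @ \oo --> l.
Proof.
move=> uv cv.
have v0 n : 0 <= v n by exact: le_trans (normc_ge0 _) (uv n).
have dom (f : R[i] -> R) : (forall z, `|f z| <= normc z) ->
    cvgn (series (f \o u)).
  move=> fle; apply: normed_cvg; apply: series_le_cvg cv => // n.
    exact: normr_ge0.
  exact: le_trans (fle _) (uv n).
have cre : cvgn (series (@complex.Re R \o u)).
  by apply: dom => -[a b] /=; rewrite -sqrtr_sqr ler_sqrt ?lerDl ?addr_ge0 ?sqr_ge0.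
have cim : cvgn (series (@complex.Im R \o u)).
  by apply: dom => -[a b] /=; rewrite -sqrtr_sqr ler_sqrt ?lerDr ?addr_ge0 ?sqr_ge0.
set a := limn (series (@complex.Re R \o u)) in cre.
set c := limn (series (@complex.Im R \o u)) in cim.
exists (a%:C%C + 'i%C * c%:C%C).
have -> : series u = fun n => ((series (@complex.Re R \o u) n)%:C%C : R[i]^o) +
    ('i%C : R[i]^o) * (series (@complex.Im R \o u) n)%:C%C.
  apply/funext => n; rewrite !seriesEord /= !rmorph_sum mulr_sumr -big_split /=.
  by apply: eq_bigr => i _; exact: complexE.
apply: cvgD; first exact: cvg_real_complex.
by apply: cvgMr; exact: cvg_real_complex.
Qed.

End ComplexNorm.

(** For nonnegative terms summability is boundedness over finite sets of pairs, and each of these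
    lies in a square. *)
Lemma summable_squares (R : realType) (f : nat -> nat -> R) :
  (forall j k, 0 <= f j k) ->
  summable [set: nat * nat] (fun jk : nat * nat => (f jk.1 jk.2)%:E) <->
  exists C, forall N, \sum_(j < N) \sum_(k < N) f j k <= C.
Proof.
move=> f0; pose sq N := [seq (j, k) | j <- iota 0 N, k <- iota 0 N].
have usq N : uniq (sq N) by apply: allpairs_uniq; rewrite ?iota_uniq // => -[? ?] [? ?].
have sqE N : (\sum_(jk \in [set` sq N]) `|(f jk.1 jk.2)%:E|)%E =
    (\sum_(j < N) \sum_(k < N) f j k)%:E.
  rewrite -fsbig_seq // big_allpairs.
  rewrite -(big_mkord xpredT (fun j => \sum_(k < N) f j k)) -sumEFin.
  rewrite /index_iota subn0; apply: eq_bigr => j _.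
  rewrite -(big_mkord xpredT (fun k => f j k)) -sumEFin /index_iota subn0.
  by apply: eq_bigr => k _ /=; rewrite ger0_norm.
have fin_sq N : finite_set [set` sq N] by exact: finite_seq.
split=> [sf|[C HC]].
  exists (fine (\esum_(jk in [set: nat * nat]) `|(f jk.1 jk.2)%:E|)%E) => N.
  rewrite -lee_fin fineK; last first.
    by rewrite ge0_fin_numE // esum_ge0.
  by rewrite -sqE; apply: esum_ge; exists [set` sq N].
rewrite /summable; apply: (@le_lt_trans _ _ C%:E); last exact: ltry.
apply: ub_ereal_sup => _ [A [finA _] <-].
have [N HN] : exists N, forall x, A x -> (x.1 < N /\ x.2 < N)%N.
  have /finite_seqP[s As] := finA; exists (\max_(x <- s) maxn x.1 x.2).+1 => x.
  rewrite As => /= xs.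
  have : (maxn x.1 x.2 <= \max_(x <- s) maxn x.1 x.2)%N.
    by rewrite (big_rem x) //= leq_maxl.
  by rewrite geq_max => /andP[]; split.
apply: le_trans (_ : (\sum_(jk \in [set` sq N]) `|(f jk.1 jk.2)%:E| <= C%:E)%E).
  apply: lee_fsum_nneg_subset => //.
  move=> [j k]; rewrite !inE /= => /HN[/= jN kN].
  by apply/allpairsP; exists (j, k); rewrite !mem_iota.
by rewrite sqE lee_fin.
Qed.

(** * The kernel as a double power series *)

Section PowerSeriesUniqueness.
Variables (R : realType) (d : nat -> nat -> R).
Hypothesis d_bounded : forall x, 0 < x ->
  exists C, forall N, \sum_(j < N) \sum_(k < N) `|d j k| * x ^+ j <= C.
Hypothesis d_cvg0 : forall x y, 0 < x -> 0 < y ->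
  (fun N => \sum_(j < N) \sum_(k < N) d j k * x ^+ j * y ^+ k) @ \oo --> (0 : R).

(** For m < N the square of side N contains the whole antidiagonal j + k = m. *)
Lemma homogeneous_part_sum m N x t : (m < N)%N ->
  t ^+ m * (\poly_(j < m.+1) d j (m - j)%N).[x] =
  \sum_(j < N) \sum_(k < N) (d j k * x ^+ j * t ^+ m) *+ (j + k == m)%N.
Proof.
move=> mN; rewrite horner_poly mulr_sumr.
rewrite (big_ord_widen N (fun j => t ^+ m * (d j (m - j)%N * x ^+ j))) //.
rewrite big_mkcond; apply: eq_bigr => j _ /=; case: ifP => jm.
  have mj : (m - j < N)%N by lia.
  rewrite (bigD1 (Ordinal mj)) //= subnKC ?eqxx ?mulr1n; last by lia.
  rewrite big1 ?addr0 1?mulrC // => k kmj.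
  have -> : (j + k == m)%N = false.
    by apply/negP => /eqP e; move/eqP: kmj; apply; apply: val_inj => /=; lia.
  by [].
by rewrite big1 // => k _; rewrite (_ : (j + k == m)%N = false) //; lia.
Qed.

(* Along (xt, t) with t -> 0 the lowest homogeneous part dominates. *)
Lemma double_power_series_unique j k : d j k = 0.
Proof.
suff H m j' k' : (j' + k' < m)%N -> d j' k' = 0 by exact: (H (j + k).+1).
elim: m j' k' {j k} => // m IH.
set h := \poly_(j < m.+1) d j (m - j)%N.
have hx x : 0 < x -> h.[x] = 0.
  move=> x0; have [C HC] := d_bounded x0.
  have C0 : 0 <= C by have := HC 0%N; rewrite big_ord0.
  (* After multiplication by t^m: terms of degree below m vanish by induction, those of degree m
     cancel against h, and those above carry t^(j+k) <= t^(m+1). *)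
  have ht t : 0 < t -> t <= 1 -> `|h.[x]| <= t * C.
    move=> t0 t1; rewrite -(ler_pM2l (exprn_gt0 m t0)) mulrA -exprSr.
    have tge0 i : 0 <= t ^+ i by rewrite exprn_ge0 // ltW.
    rewrite -{1}[t ^+ m]ger0_norm // -normrM.
    have c1 : (fun N => `|\sum_(j < N) \sum_(k < N) d j k * (x * t) ^+ j * t ^+ k
        - t ^+ m * h.[x]|) @ \oo --> `|t ^+ m * h.[x]|.
      rewrite (_ : `|_| = `|0 - t ^+ m * h.[x]|); last by rewrite sub0r normrN.
      apply: cvg_norm.
      apply: cvgB; last exact: cvg_cst.
      by apply: d_cvg0 => //; exact: mulr_gt0.
    rewrite -(cvg_lim (@Rhausdorff R) c1); apply: limr_le; first exact: cvgP c1.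
    near=> N; have mN : (m < N)%N by near: N; exact: nbhs_infty_gt.
    rewrite (homogeneous_part_sum _ _ mN) -sumrB.
    apply: (@le_trans _ _ (t ^+ m.+1 * \sum_(j < N) \sum_(k < N) `|d j k| * x ^+ j)).
      rewrite mulr_sumr; apply: le_trans (ler_norm_sum _ _ _) _.
      apply: ler_sum => j _; rewrite -sumrB mulr_sumr.
      apply: le_trans (ler_norm_sum _ _ _) _; apply: ler_sum => k _.
      have xj : 0 <= x ^+ j by rewrite exprn_ge0 // ltW.
      have rhs0 : 0 <= t ^+ m.+1 * (`|d j k| * x ^+ j).
        by rewrite !mulr_ge0 ?exprn_ge0 // ltW.
      rewrite exprMn; case: (ssrnat.ltngtP (j + k) m) => jkm.
      - by rewrite IH // !mul0r mul0rn subr0 normr0 mul0r mulr0.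
      - rewrite mulr0n subr0 mulrA -mulrA -exprD normrM normrM (ger0_norm xj).
        rewrite [X in _ <= X]mulrC ler_wpM2l ?mulr_ge0 //.
        by rewrite ger0_norm // ler_wiXn2l // ltW.
      - by rewrite mulr1n mulrA -mulrA -exprD jkm subrr normr0.
    by rewrite ler_wpM2l ?exprn_ge0 // ltW.
  apply/eqP; rewrite -normr_eq0; apply/negP => /negP h0.
  have hp : 0 < `|h.[x]| by rewrite lt_neqAle eq_sym h0 normr_ge0.
  have den : 0 < `|h.[x]| + C + 1 by lra.
  (* This t lies in ]0, 1] and satisfies t C < |h(x)|, a contradiction. *)
  have := ht (`|h.[x]| / (`|h.[x]| + C + 1)).
  rewrite divr_gt0 // ler_pdivrMr // mul1r => /(_ isT).
  have -> : `|h.[x]| <= `|h.[x]| + C + 1 by lra.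
  move=> /(_ isT); rewrite mulrAC ler_pdivlMr // ler_pM2l //; lra.
have h0 : h = 0.
  (* The positive integers 1, ..., [size h] are more roots than the degree allows. *)
  apply: (@roots_geq_poly_eq0 _ _ [seq i.+1%:R | i <- iota 0 (size h)]).
  - by apply/allP => _ /mapP[i _ ->]; rewrite /root hx.
  - rewrite map_inj_uniq ?iota_uniq // => a b /eqP.
    by rewrite eqr_nat => /eqP[].
  - by rewrite size_map size_iota.
move=> j k; rewrite ltnS leq_eqVlt => /predU1P[jk|]; last exact: IH.
have /(congr1 (fun p : {poly R} => p`_j)) := h0.
rewrite coef_poly coef0 (_ : (j < m.+1)%N); last lia.
by rewrite (_ : (m - j)%N = k) //; lia.
Unshelve. all: by end_near. Qed.

End PowerSeriesUniqueness.

(** * Expansion of the kernel with coefficients [kernel_matrix] *)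

Section KernelPowerSeries.
Variables (R : realType) (P : nat -> {poly R}).
Hypothesis size_P : forall n, size (P n) = n.+1.
Hypothesis P_bounded : forall r, 0 < r ->
  exists C, forall N, \sum_(n < N) abs_horner (P n) r ^+ 2 <= C.

Lemma abs_horner_trunc (p : {poly R}) N r : 0 <= r ->
  \sum_(k < N) `|p`_k| * r ^+ k <= abs_horner p r.
Proof.
move=> r0; rewrite (abs_horner_wide (m := maxn N (size p))) ?leq_maxr //.
rewrite (big_ord_widen (maxn N (size p)) (fun k => `|p`_k| * r ^+ k)) ?leq_maxl //.
rewrite big_mkcond; apply: ler_sum => k _; case: ifP => // _.
by rewrite mulr_ge0 ?exprn_ge0.
Qed.

(** With the series cut at n < M, the double sum is at most the sum over n of the squares of the
    truncated [abs_horner (P n) r], a bound uniform in M and N. *)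
Lemma kernel_matrix_bounded r : 0 < r -> exists C, forall N,
  \sum_(j < N) \sum_(k < N) `|kernel_matrix P j k| * r ^+ j * r ^+ k <= C.
Proof.
move=> r0; have [C HC] := P_bounded r0; exists C => N.
pose AM M j k := \sum_(n < M) (P n)`_j * (P n)`_k.
have c1 : (fun M => \sum_(j < N) \sum_(k < N) `|AM M j k| * r ^+ j * r ^+ k)
    @ \oo --> \sum_(j < N) \sum_(k < N) `|kernel_matrix P j k| * r ^+ j * r ^+ k.
  apply: cvg_bigsum => j; apply: cvg_bigsum => k; apply: cvgMl; apply: cvgMl.
  apply: cvg_norm.
  by have := @cvg_kernel_matrix _ _ P_bounded j k; rewrite seriesEord.
rewrite -(cvg_lim (@Rhausdorff R) c1); apply: limr_le; first exact: cvgP c1.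
apply: nearW => M; apply: le_trans (HC M).
apply: (@le_trans _ _ (\sum_(n < M) (\sum_(j < N) `|(P n)`_j| * r ^+ j) ^+ 2)).
  under [X in _ <= X]eq_bigr do rewrite expr2 mulr_suml.
  rewrite [X in _ <= X]exchange_big /=; apply: ler_sum => j _.
  under [X in _ <= X]eq_bigr do rewrite mulr_sumr.
  rewrite [X in _ <= X]exchange_big /=; apply: ler_sum => k _.
  rewrite -mulrA; apply: (@le_trans _ _
      ((\sum_(n < M) `|(P n)`_j * (P n)`_k|) * (r ^+ j * r ^+ k))).
    by apply: ler_wpM2r; [rewrite mulr_ge0 ?exprn_ge0 // ltW|exact: ler_norm_sum].
  rewrite mulr_suml; apply: ler_sum => n _.
  by rewrite normrM mulrACA.
have r0' := ltW r0; apply: ler_sum => n _.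
rewrite lerXn2r ?nnegrE ?abs_horner_trunc ?abs_horner_ge0 //.
by apply: sumr_ge0 => k _; rewrite mulr_ge0 ?exprn_ge0.
Qed.

(** The square sum [E N] is the sum over n of products of P_n(z) and P_n(w) truncated below degree
    N. Truncation is exact for n < N; for n >= N both the full and the truncated product are at most
    [Q n ^+ 2], so the error is at most twice a tail. *)
Lemma kernel_matrix_double_power_series :
  double_power_series (moment_kernel P) (kernel_matrix P).
Proof.
move=> z w; pose r := 1 + normc z + normc w.
have z0 := normc_ge0 z; have w0 := normc_ge0 w.
have r0 : 0 < r by rewrite /r; lra.
have zr : normc z <= r by rewrite /r; lra.
have wr : normc w <= r by rewrite /r; lra.
split.
  apply/(summable_squares (f := fun j k => `|kernel_matrix P j k| *
     normc z ^+ j * normc w ^+ k)) => [j k|].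
    by rewrite !mulr_ge0 ?exprn_ge0.
  have [C HC] := kernel_matrix_bounded r0; exists C => N.
  apply: le_trans (HC N); apply: ler_sum => j _; apply: ler_sum => k _.
  apply: ler_pM; rewrite ?mulr_ge0 ?exprn_ge0 //.
    by rewrite ler_wpM2l // lerXn2r ?nnegrE // ltW.
  by rewrite lerXn2r ?nnegrE // ltW.
pose Q n := abs_horner (P n) r.
have Q0 n : 0 <= Q n by rewrite abs_horner_ge0 // ltW.
pose tr N n (y : R[i]) : R[i]^o := \sum_(k < N) ((P n)`_k)%:C%C * y ^+ k.
have trQ N n y : normc y <= r -> normc (tr N n y) <= Q n.
  move=> yr; apply: le_trans (abs_horner_trunc (P n) N (ltW r0)).
  apply: normc_sum_le => k; rewrite ComplexField.Normc.normcM normcX normc_real.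
  by rewrite ler_wpM2l // lerXn2r ?nnegrE ?normc_ge0 // ltW.
have cevalE N n y : (n < N)%N -> ceval (P n) y = tr N n y.
  move=> nN; rewrite /ceval (@horner_coef_wide _ N) ?size_map_poly ?size_P //.
  by apply: eq_bigr => k _; rewrite coef_map.
pose u n : R[i]^o := ceval (P n) z * ceval (P n) w.
have cQ : cvgn (series (fun n => Q n ^+ 2)) by exact: cvg_abs_horner_sq.
have [|l ul] := @normc_series_cvg _ u _ _ cQ.
  move=> n; rewrite /u (cevalE n.+1) // (cevalE n.+1) //.
  rewrite ComplexField.Normc.normcM expr2.
  by apply: ler_pM; rewrite ?normc_ge0 ?trQ.
have -> : moment_kernel P z w = l.
  exact: (cvg_lim (@norm_hausdorff _ R[i]^o) ul).
pose T := limn (series (fun n => Q n ^+ 2)).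
pose E N : R[i]^o := \sum_(j < N) \sum_(k < N)
  real_complex R (kernel_matrix P j k) * z ^+ j * w ^+ k.
have tail N : normc (l - E N) <= 2 * (T - series (fun n => Q n ^+ 2) N).
  have c1 : (fun M => series u M - \sum_(n < M) tr N n z * tr N n w : R[i]^o)
      @ \oo --> (l - E N : R[i]^o).
    apply: cvgB; first exact: ul.
    have -> : (fun M => \sum_(n < M) tr N n z * tr N n w : R[i]^o) =
        fun M => \sum_(j < N) \sum_(k < N)
          ((\sum_(n < M) (P n)`_j * (P n)`_k)%:C%C : R[i]^o) * z ^+ j * w ^+ k.
      apply/funext => M; under eq_bigr do rewrite mulr_suml.
      rewrite exchange_big /=; apply: eq_bigr => j _.
      under eq_bigr do rewrite mulr_sumr.
      rewrite exchange_big /=; apply: eq_bigr => k _.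
      rewrite rmorph_sum -mulrA mulr_suml; apply: eq_bigr => n _.
      by rewrite rmorphM mulrACA.
    apply: cvg_bigsum => j; apply: cvg_bigsum => k; apply: cvgMl; apply: cvgMl.
    apply: cvg_real_complex.
    by have := @cvg_kernel_matrix _ _ P_bounded j k; rewrite seriesEord.
  apply: (normc_lim_le c1); near=> M.
  have NM : (N <= M)%N by near: M; exact: nbhs_infty_ge.
  rewrite seriesEord /= -sumrB -(big_mkord xpredT (fun n => u n - tr N n z * tr N n w)).
  rewrite (big_cat_nat (leq0n _) NM) /= big_nat.
  rewrite big1 ?add0r => [|n /andP[_ nN]]; last first.
    by rewrite /u !(cevalE N) // subrr.
  apply: (@le_trans _ _ (\sum_(N <= n < M) 2 * Q n ^+ 2)).
    elim/big_rec2: _ => [|n y x _ xy]; first by rewrite ComplexField.Normc.normc0.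
    apply: le_trans (normcD _ _) _; apply: lerD => //.
    apply: le_trans (normcD _ _) _; rewrite normc_opp.
    rewrite /u (cevalE n.+1) // (cevalE n.+1) // !ComplexField.Normc.normcM.
    by rewrite expr2 mulr_natl mulr2n lerD // ler_pM ?normc_ge0 ?trQ.
  rewrite -mulr_sumr ler_wpM2l //.
  have -> : \sum_(N <= n < M) Q n ^+ 2 =
     series (fun n => Q n ^+ 2) M - series (fun n => Q n ^+ 2) N.
    by rewrite /series /= [in RHS](big_cat_nat (leq0n _) NM) //= addrAC subrr add0r.
  rewrite lerB //; apply: nondecreasing_cvgn_le => //.
  by apply: nondecreasing_series => n _ _; exact: sqr_ge0.
have c0 : (fun N => 2 * (T - series (fun n => Q n ^+ 2) N)) @ \oo --> (0 : R).
  rewrite -[X in _ --> X](mulr0 2) -(subrr T); apply: cvgMr.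
  by apply: cvgB => //; exact: cvg_cst.
apply/cvg_normcP => e e0; near=> N.
apply: le_trans (tail N) _; apply: le_trans (ler_norm _) _.
by near: N; exact: (cvgr0_norm_le _ c0).
Unshelve. all: by end_near. Qed.

End KernelPowerSeries.

(** * Uniqueness of the coefficient array *)

Section KernelCoefficients.
Variable R : realType.
Implicit Types (F : R[i] -> R[i] -> R[i]^o) (a : nat -> nat -> R).

Lemma double_power_series_real a x y N :
  \sum_(j < N) \sum_(k < N) real_complex R (a j k) * x%:C%C ^+ j * y%:C%C ^+ k
  = (\sum_(j < N) \sum_(k < N) a j k * x ^+ j * y ^+ k)%:C%C.
Proof.
rewrite rmorph_sum; apply: eq_bigr => j _; rewrite rmorph_sum.
by apply: eq_bigr => k _; rewrite !rmorphM !rmorphXn.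
Qed.

Lemma double_power_series_inj F a a' :
  double_power_series F a -> double_power_series F a' -> a = a'.
Proof.
move=> Fa Fa'; apply/funext => j; apply/funext => k; apply/eqP.
rewrite -subr_eq0; apply/eqP.
apply: (double_power_series_unique (d := fun j k => a j k - a' j k)) => [x x0|x y x0 y0].
  have bd c : double_power_series F c ->
      exists C, forall N, \sum_(j < N) \sum_(k < N) `|c j k| * x ^+ j <= C.
    (* At w = 1 the powers of the second variable disappear from the bound. *)
    move=> /(_ x%:C%C 1) [+ _].
    move/(summable_squares (f := fun j k => `|c j k| * normc x%:C%C ^+ j * normc 1 ^+ k)).
    case=> [i l|C HC]; first by rewrite !mulr_ge0 ?exprn_ge0 ?normc_ge0.
    exists C => N; apply: le_trans (HC N); apply: ler_sum => i _; apply: ler_sum => l _.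
    rewrite normc_real ComplexField.Normc.normc1 expr1n mulr1.
    by rewrite (ger0_norm (ltW x0)).
  have [C HC] := bd _ Fa; have [C' HC'] := bd _ Fa'; exists (C + C') => N.
  apply: le_trans (lerD (HC N) (HC' N)); rewrite -big_split /=.
  apply: ler_sum => i _; rewrite -big_split /=; apply: ler_sum => l _.
  by rewrite -mulrDl ler_wpM2r ?exprn_ge0 ?ler_normB // ltW.
have [_ ca] := Fa x%:C%C y%:C%C; have [_ ca'] := Fa' x%:C%C y%:C%C.
have := cvgB ca ca'; rewrite subrr => /(_ _) /cvg_normcP H.
apply/cvgrPdist_le => e /H; apply: filterS => N.
rewrite !fctE !double_power_series_real -rmorphB sub0r normc_opp normc_real sub0r normrN.
rewrite -sumrB; congr (`|_| <= _); apply: eq_bigr => i _; rewrite -sumrB.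
by apply: eq_bigr => l _; rewrite !mulrBl.
Qed.

(** The existence of [a] rules out the default value of [xget], and uniqueness makes its choice
    equal to [a]. *)
Lemma kernel_coefE (P : nat -> {poly R}) a :
  double_power_series (moment_kernel P) a -> kernel_coef P = a.
Proof.
move=> Pa; apply: (double_power_series_inj (F := moment_kernel P)) => //.
exact: (@xgetI _ (fun _ _ => 0) [set a | double_power_series (moment_kernel P) a] a).
Qed.

End KernelCoefficients.

Theorem proposition2p5 (R : realType) (mu : probability (measurableTypeR R) R)
    (P : nat -> {poly R})
    (mu_infinite_support : infinite_set (msupport mu))
    (mu_moments : has_moments mu)
    (P_orthonormal : orthonormal_polys mu P)
    (mu_symmetric : symmetric_recurrence P)
    (mu_indeterminate : indeterminate mu) :
  prop_ac mu P <-> prop_aci mu P.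
Proof.
split=> [ac|[]] //; split=> // i j.
have [size_P lead_P _] := P_orthonormal.
(* Indeterminacy enters through this bound, which gives [kernel_coef] its explicit form. *)
have P_bounded := indeterminate_abs_horner_bounded mu_moments P_orthonormal
  mu_symmetric mu_indeterminate.
have kE := kernel_coefE (kernel_matrix_double_power_series size_P P_bounded).
have [b [b0 rec0 recS]] := mu_symmetric.
have := ac i j; rewrite kE.
exact: (kernel_moment_series size_P P_bounded lead_P b0 rec0 recS mu_moments
  P_orthonormal).
Qed.
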